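(* Let $I(2,n)$, $n\ge1$, be the number of iterations required in the random game $G(2,n)$ conditional on strict-dominance solvability. Then: 1. $\mathbb{E}\left[I(2,n)\right]=3-\dfrac{n+2^{n-1}}{2^n}\cdot\sqrt{\pi}\cdot\dfrac{\Gamma(n)}{\Gamma(n+1/2)}$; 2. $\mathbb{E}\left[I(2,n)\right]$ is strictly increasing in $n$; 3. $\lim_{n\to\infty}n^{1/2}\cdot\left(3-\mathbb{E}\left[I(2,n)\right]\right)=\dfrac{\sqrt{\pi}}{2}$.
   Context: Random game $G(m,n)$ ($m,n\ge1$ integers): there are two players, Row with action set $[m]=\{1,\dots,m\}$ and Column with action set $[n]$. Payoffs are given by $m\times n$ matrices $R=(r_{ij})$ (Row's payoffs) and $C=(c_{ij})$ (Column's payoffs). For each $j\in[n]$ the column $r_{\cdot j}=(r_{1j},\dots,r_{mj})$ is a uniformly random permutation of $[m]$; for each $i\in[m]$ the row $c_{i\cdot}=(c_{i1},\dots,c_{in})$ is a uniformly random permutation of $[n]$; all these $m+n$ random permutations are mutually independent. Dominance (by pure actions only): in a (sub)game with row set $Y\subseteq[m]$ and column set $X\subseteq[n]$, Row's action $i\in Y$ is strictly dominated if there is $i'\in Y$ with $r_{i'x}>r_{ix}$ for all $x\in X$; Column's action $j\in X$ is strictly dominated if there is $j'\in X$ with $c_{yj'}>c_{yj}$ for all $y\in Y$. Iterated elimination: in each round (iteration), both players simultaneously delete all their actions that are strictly dominated in the current subgame; the procedure stops when there are no strictly dominated actions. The number of iterations is the number of rounds in which at least one action is deleted. The game is strict-dominance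 solvable if exactly one action is left for each player at the end. $I(m,n)$ denotes a random variable whose distribution is the conditional distribution of the number of iterations in $G(m,n)$ given that $G(m,n)$ is strict-dominance solvable. Here $\pi$ is the usual constant and $\Gamma$ the gamma function. *)

(* Defs.v *)
From HB Require Import structures.
From mathcomp Require Import all_boot all_order all_algebra all_fingroup.
From mathcomp Require Import all_classical all_reals all_analysis.

Set Implicit Arguments.
Unset Strict Implicit.
Unset Printing Implicit Defensive.

Import Order.TTheory GRing.Theory Num.Theory.
Import numFieldNormedType.Exports.

Local Open Scope ring_scope.

(* Actions are numbered from 0, as elements of 'I_m and 'I_n. *)
Section Elimination.
Variables (m n : nat) (A B : 'M[nat]_(m, n)).

Definition subgame : finType := ({set 'I_m} * {set 'I_n})%type.

Implicit Type s : subgame.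

Definition row_dominated s (i : 'I_m) : bool :=
  [exists i' in s.1, [forall x in s.2, (A i x < A i' x)%N]].

Definition col_dominated s (j : 'I_n) : bool :=
  [exists j' in s.2, [forall y in s.1, (B y j < B y j')%N]].

Definition eliminate s : subgame :=
  ([set i in s.1 | ~~ row_dominated s i], [set j in s.2 | ~~ col_dominated s j]).

Definition undominated s : bool :=
  [forall i in s.1, ~~ row_dominated s i] &&
  [forall j in s.2, ~~ col_dominated s j].

Definition after_rounds (k : nat) : subgame :=
  iter k eliminate ([set: 'I_m], [set: 'I_n]).

Lemma eliminate_decr s : ~~ undominated s ->
  (#|(eliminate s).1| + #|(eliminate s).2| < #|s.1| + #|s.2|)%N.
Proof.
have sub1 : (eliminate s).1 \subset s.1.
  by apply/fintype.subsetP => i; rewrite inE => /andP[].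
have sub2 : (eliminate s).2 \subset s.2.
  by apply/fintype.subsetP => j; rewrite inE => /andP[].
rewrite negb_and => /orP[] /forallPn[a]; rewrite negb_imply negbK => /andP[sa da].
- have lt1 : (#|(eliminate s).1| < #|s.1|)%N.
    apply: proper_card; apply/fintype.properP; split=> //.
    by exists a => //; rewrite inE da andbF.
  by rewrite -addSn leq_add // subset_leq_card.
- have lt2 : (#|(eliminate s).2| < #|s.2|)%N.
    apply: proper_card; apply/fintype.properP; split=> //.
    by exists a => //; rewrite inE da andbF.
  by rewrite -addnS leq_add // subset_leq_card.
Qed.

Lemma elimination_stops : exists k, undominated (after_rounds k).
Proof.
apply: contrapT => nostop.
have bound k : (#|(after_rounds k).1| + #|(after_rounds k).2| + k <= m + n)%N.
  elim: k => [|k IHk]; first by rewrite addn0 !cardsT !card_ord.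
  apply: leq_trans IHk; rewrite -addSnnS leq_add2r.
  by apply: eliminate_decr; apply/negP => stop; apply: nostop; exists k.
by have := leq_trans (leq_addl _ _) (bound (m + n).+1); rewrite ltnn.
Qed.

(* The first time no strictly dominated action is left; equivalently, every
   earlier round, and no later one, deletes an action. *)
Definition iterations : nat := ex_minn elimination_stops.

Definition dominance_solvable : bool :=
  (#|(after_rounds iterations).1| == 1)%N &&
  (#|(after_rounds iterations).2| == 1)%N.

End Elimination.

(* An outcome gives the permutation r_{.j} for each column j and the
   permutation c_{i.} for each row i. *)
Definition game (m n : nat) : finType :=
  ({ffun 'I_n -> 'S_m} * {ffun 'I_m -> 'S_n})%type.

Definition row_payoff (m n : nat) (g : game m n) : 'M[nat]_(m, n) :=
  \matrix_(i, j) (g.1 j i).+1.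

Definition col_payoff (m n : nat) (g : game m n) : 'M[nat]_(m, n) :=
  \matrix_(i, j) (g.2 i j).+1.

Definition game_iterations (m n : nat) (g : game m n) : nat :=
  iterations (row_payoff g) (col_payoff g).

Definition game_solvable (m n : nat) (g : game m n) : bool :=
  dominance_solvable (row_payoff g) (col_payoff g).

(* Product of the uniform laws of the m + n independent permutations. *)
Definition game_mass (R : realType) (m n : nat) (g : game m n) : R :=
  (\prod_(j < n) (m`!%:R)^-1) * (\prod_(i < m) (n`!%:R)^-1).

Definition game_prob (R : realType) (m n : nat) (E : pred (game m n)) : R :=
  \sum_(g | E g) game_mass R g.

(* The law of X is the conditional law of the number of iterations given that the
   game is solvable; the point masses determine it, since they sum to 1. *)
Definition iterations_law (R : realType) (m n : nat) (d : measure_display)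
    (T : measurableType d) (P : probability T R) (X : {RV P >-> R}) : Prop :=
  forall k : nat,
    P (X @^-1` [set k%:R])%classic =
    (game_prob R (fun g : game m n => (game_iterations g == k) && game_solvable g)
     / game_prob R (@game_solvable m n))%:E.

(* Euler's integral, meaningful for s > 0. *)
Definition Gamma (R : realType) (s : R) : R :=
  (\int[@lebesgue_measure R]_(x in `]0%R, +oo[) (x `^ (s - 1) * expR (- x)))%R.

(* Main.v *)
(** Let K be the number of Column's actions that
    survive the first round; they are the columns that are maximal for the two
    rows of payoffs at once.  Row's surviving actions are decided by Row's
    preferences on these K columns, so the game is solvable iff Row prefers the
    same action on all of them, and then
      3 - (number of iterations) = [same preference on all n columns] + [K = 1].
    Since K is distributed as the number of records of a random permutation,
    E[x^K] = x (x + 1) ... (x + n - 1) / n!, so solvability has probability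
    E[2^(1-K)] = 2 (1/2) (3/2) ... (n - 1/2) / n!, while the two events on the
    right-hand side have probabilities 2^(1-n) and 1/n.  The Gamma function enters
    through Gamma(n + 1/2) = sqrt(pi) (1/2) (3/2) ... (n - 1/2), and the limit
    follows from sqrt(n) Gamma(n) / Gamma(n + 1/2) -> 1, a consequence of
    Gamma(s + 1/2) <= sqrt(s) Gamma(s) at s = n and s = n + 1/2. *)
Require Import Defs.
From HB Require Import structures.
From mathcomp Require Import all_boot all_order all_algebra all_fingroup.
From mathcomp Require Import all_classical all_reals all_analysis.
From mathcomp Require Import measurable_realfun zify ring lra.
Import Order.TTheory GRing.Theory Num.Theory.
Import numFieldNormedType.Exports.
Local Open Scope classical_set_scope.
Local Open Scope ring_scope.

(** * The Gamma function at integers and half-integers *)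

Definition gamma_integrand (R : realType) (s x : R) : R :=
  x `^ (s - 1) * expR (- x).

Lemma gamma_integrand_ge0 (R : realType) (s x : R) : 0 <= gamma_integrand R s x.
Proof. by rewrite mulr_ge0 ?powR_ge0 ?expR_ge0. Qed.

Lemma measurable_gamma_integrand (R : realType) (s : R) (A : set R) :
  measurable_fun A (gamma_integrand R s).
Proof.
apply: measurable_funTS; apply: measurable_funM => //.
by apply: measurableT_comp => //; exact: measurableT_comp.
Qed.

(** Monotone convergence along segments exhausting the open half-line. It carries calculus on
    compact intervals over to Euler's integral, whose integrand may blow up at 0. *)
Lemma integral_pos_cvg (R : realType) (f : R -> R) (a b : nat -> R) :
  measurable_fun (`]0%R, +oo[ : set R) f -> (forall x, 0 < x -> 0 <= f x) ->
  (forall k, 0 < a k) ->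
  nonincreasing_seq a -> a @ \oo --> 0 ->
  nondecreasing_seq b -> b @ \oo --> +oo ->
  (\int[@lebesgue_measure R]_(x in `[a k, b k]) (f x)%:E)%E @[k --> \oo] -->
  (\int[@lebesgue_measure R]_(x in `]0%R, +oo[) (f x)%:E)%E.
Proof.
move=> mf f0 a0 na ca nb cb.
have sub k : (`[a k, b k] : set R) `<=` `]0%R, +oo[.
  by move=> x /=; rewrite !in_itv/= andbT => /andP[+ _]; exact: lt_le_trans.
suff -> : `]0%R, +oo[%classic = \bigcup_k `[a k, b k]%classic :> set R.
  apply: ge0_nondecreasing_set_cvg_integral => //.
  - move=> i j ij; apply/subsetPset => x /=; rewrite !in_itv/= => /andP[ax xb].
    by rewrite (le_trans (na _ _ ij) ax) (le_trans xb (nb _ _ ij)).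
  - by move=> i; apply/measurable_EFinP; exact: measurable_funS mf.
  - by move=> i x /sub /=; rewrite in_itv/= andbT lee_fin; exact: f0.
apply/seteqP; split => [x /=|x [k _ /sub]//]; rewrite in_itv/= andbT => x0.
near \oo => k; exists k => //=; rewrite in_itv/=; apply/andP; split.
  near: k; have /cvgrPdist_le/(_ _ x0) := ca; apply: filterS => k.
  by rewrite sub0r normrN gtr0_norm.
by near: k; move/cvgryPge : cb; exact.
Unshelve. all: by end_near. Qed.

Lemma derivable_pos_itv (R : realType) (f : R -> R) (a b : R) :
  (forall x, 0 < x -> derivable f x 1) -> 0 < a -> a < b ->
  derivable_oo_LRcontinuous f a b.
Proof.
move=> df a0 ab.
have cf x : 0 < x -> {for x, continuous f}.
  by move=> x0; apply/differentiable_continuous/derivable1_diffP/df.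
split => [x||].
- by rewrite in_itv/= => /andP[ax _]; apply: df; exact: lt_trans ax.
- exact/cvg_at_right_filter/cf.
- by apply/cvg_at_left_filter/cf; exact: lt_trans ab.
Qed.

Lemma is_derive_expRN (R : realType) (x : R) :
  is_derive x 1 (fun x : R => expR (- x)) (- expR (- x)).
Proof.
by apply: is_derive_eq; rewrite /= mulrN1.
Qed.

Lemma derivable_powR_pos (R : realType) (s x : R) : 0 < x ->
  derivable (fun x => x `^ s) x 1.
Proof. by move=> x0; apply: derivable_powR; rewrite in_itv/= x0. Qed.

Lemma derivable_gamma_integrand (R : realType) (s x : R) : 0 < x ->
  derivable (gamma_integrand R s) x 1.
Proof.
move=> x0; apply: derivableM; first exact: derivable_powR_pos.
by apply: ex_derive; exact: is_derive_expRN.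
Qed.

(** The exponential is integrated to - exp(-x) and the power x^s is differentiated. *)
Lemma gamma_integrand_by_parts (R : realType) (s a b : R) : 0 < a -> a < b ->
  (\int[@lebesgue_measure R]_(x in `[a, b]) (gamma_integrand R (s + 1) x) =
   a `^ s * expR (- a) - b `^ s * expR (- b) +
   s * \int[@lebesgue_measure R]_(x in `[a, b]) (gamma_integrand R s x))%R.
Proof.
move=> a0 ab.
have dE (x : R) : is_derive x 1 (fun x : R => - expR (- x)) (expR (- x)).
  rewrite -[X in is_derive _ _ _ X]opprK.
  by apply: is_deriveN; exact: is_derive_expRN.
have cE : {within `[a, b], continuous (fun x : R => expR (- x))}.
  apply: continuous_subspaceT => x.
  by apply: continuous_comp => //; [exact: continuousN|exact: continuous_expR].
have cp r : {within `[a, b], continuous (fun x : R => x `^ r)}.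
  apply: derivable_oo_LRcontinuous_within; apply: derivable_pos_itv => //.
  by move=> x; exact: derivable_powR_pos.
have cg : {within `[a, b], continuous (gamma_integrand R s)}.
  apply: derivable_oo_LRcontinuous_within; apply: derivable_pos_itv => //.
  by move=> x; exact: derivable_gamma_integrand.
rewrite /gamma_integrand addrK.
rewrite (@Rintegration_by_parts R (fun x => x `^ s) (fun x => - expR (- x))
  (fun x => s * x `^ (s - 1)) (fun x => expR (- x)))//.
- under eq_Rintegral do rewrite mulrN -mulrA -mulNr.
  rewrite RintegralZl//; first by ring.
  by apply: continuous_compact_integrable; [exact: segment_compact|exact: cg].
- apply: derivable_oo_LRcontinuous_within; apply: derivable_pos_itv => // x x0.
  by apply: derivableM => //; exact: derivable_powR_pos.
- by apply: derivable_pos_itv => // x; exact: derivable_powR_pos.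
- move=> x; rewrite in_itv/= => /andP[ax _]; apply: powR_derive1.
  by rewrite in_itv/= (lt_trans a0 ax).
- by apply: derivable_pos_itv => // x _; apply: ex_derive; exact: dE.
- by move=> x _; rewrite derive1E; apply: derive_val; exact: dE.
Qed.

Lemma cvg_natr2 (R : realType) : (k.+2%:R : R) @[k --> \oo] --> +oo.
Proof.
apply/cvgryPge => M; near=> k.
have : M <= k%:R.
  by near: k; move: M; apply/cvgryPge; exact: cvgr_idn.
by move/le_trans; apply; rewrite ler_nat -addn2 leq_addr.
Unshelve. all: by end_near. Qed.

Lemma cvg_invr_natr2 (R : realType) : (k.+2%:R^-1 : R) @[k --> \oo] --> 0.
Proof.
apply: (proj2 (@gtr0_cvgV0 R nat \oo _ (fun k => k.+2%:R) _)); last exact: cvg_natr2.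
by near=> k; rewrite ltr0n.
Unshelve. all: by end_near. Qed.

(** Raise 1 + y <= exp(y) at y = x / (2 s) to the power s. Half of the exponential decay is left
    over, which is enough to force the limit 0 at infinity. *)
Lemma powR_expRN_le (R : realType) (s x : R) : 0 < s -> 0 <= x ->
  x `^ s * expR (- x) <= (2 * s) `^ s * expR (- (x / 2)).
Proof.
move=> s0 x0.
have s20 : 0 < 2 * s by rewrite mulr_gt0.
have E : x `^ s <= (2 * s) `^ s * expR (x / 2).
  rewrite -[X in X `^ s <= _](divfK (lt0r_neq0 s20)) (powRM s (divr_ge0 x0 (ltW s20)) (ltW s20)).
  rewrite [leRHS]mulrC ler_wpM2r ?powR_ge0//.
  rewrite (_ : x / 2 = x / (2 * s) * s); last by field; rewrite gt_eqF.
  rewrite expRM; apply: ge0_ler_powR;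
    rewrite ?nnegrE ?(divr_ge0 x0 (ltW s20)) ?expR_ge0 ?(ltW s0)//.
  by rewrite (le_trans _ (expR_ge1Dx _))// lerDr.
rewrite (le_trans (ler_wpM2r (expR_ge0 _) E))// -mulrA -expRD.
by rewrite (_ : x / 2 - x = - (x / 2))//; field.
Qed.

(** These are the boundary terms of the integration by parts: at 0 the factor x^s vanishes because s
    > 0, at infinity the exponential wins. *)
Lemma cvg_gamma_boundary (R : realType) (s : R) : 0 < s ->
  (k.+2%:R^-1 `^ s * expR (- k.+2%:R^-1) - k.+2%:R `^ s * expR (- k.+2%:R) : R)
    @[k --> \oo] --> 0.
Proof.
move=> s0; rewrite -[X in _ --> X](subr0 0); apply: cvgB.
  apply: (@squeeze_cvgr _ _ _ _ (fun=> 0) (fun k => k.+2%:R^-1 `^ s)).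
  - near=> k; rewrite mulr_ge0 ?powR_ge0 ?expR_ge0//=.
    by rewrite ler_piMr ?powR_ge0// -expR0 ler_expR oppr_le0 invr_ge0.
  - exact: cvg_cst.
  - have /cvg_at_rightP := powR_cvg0 s0; apply; split => [k|].
      by rewrite invr_gt0.
    exact: cvg_invr_natr2.
apply: (@squeeze_cvgr _ _ _ _ (fun=> 0)
    (fun k => (2 * s) `^ s * expR (- (k.+2%:R / 2)))).
- near=> k; rewrite mulr_ge0 ?powR_ge0 ?expR_ge0//=.
  exact: powR_expRN_le.
- exact: cvg_cst.
- rewrite -[X in _ --> X](mulr0 ((2 * s) `^ s)); apply: cvgMl_tmp.
  apply: (cvg_comp (fun k => k.+2%:R) (fun x => expR (- (x / 2))) (@cvg_natr2 R)).
  apply: (cvg_comp (fun x => x / 2) (fun x => expR (- x)) _ (@cvgr_expR R)).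
  by apply: gt0_cvgMly => //; exact: cvg_id.
Unshelve. all: by end_near. Qed.

(** The shift by 2 gives 1/(k+2) < 1 < k+2, so that no segment is degenerate. The limit is taken in
    the extended reals, so finiteness is not presupposed. *)
Lemma cvg_gamma_integral (R : realType) (s : R) :
  (\int[@lebesgue_measure R]_(x in `[k.+2%:R^-1, k.+2%:R]) gamma_integrand R s x)%R%:E
    @[k --> \oo] -->
  (\int[@lebesgue_measure R]_(x in `]0%R, +oo[) (gamma_integrand R s x)%:E)%E.
Proof.
under eq_cvg => k.
  rewrite /Rintegral fineK; last first.
    apply: integrable_fin_num => //.
    apply: continuous_compact_integrable; first exact: segment_compact.
    apply: derivable_oo_LRcontinuous_within; apply: derivable_pos_itv.
    + by move=> x; exact: derivable_gamma_integrand.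
    + by rewrite invr_gt0 ltr0n.
    + by rewrite (@lt_le_trans _ _ 1) ?ler1n// invf_lt1 ?ltr1n.
  over.
apply: (@integral_pos_cvg R _ (fun k => k.+2%:R^-1) (fun k => k.+2%:R)).
- exact: measurable_gamma_integrand.
- by move=> x _; exact: gamma_integrand_ge0.
- by move=> k; rewrite invr_gt0 ltr0n.
- by move=> i j ij; rewrite lef_pV2 ?posrE ?ltr0n// ler_nat !ltnS.
- exact: cvg_invr_natr2.
- by move=> i j ij; rewrite ler_nat !ltnS.
- exact: cvg_natr2.
Qed.

(** The functional equation of Gamma. A real value of the extended integral carries finiteness along
    the recursion; a real-valued integral would hide it, since [Rintegral] sends an infinite
    integral to 0. *)
Lemma gamma_integralS (R : realType) (s v : R) : 0 < s ->
  (\int[@lebesgue_measure R]_(x in `]0%R, +oo[) (gamma_integrand R s x)%:E = v%:E)%E ->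
  (\int[@lebesgue_measure R]_(x in `]0%R, +oo[) (gamma_integrand R (s + 1) x)%:E =
   (s * v)%:E)%E.
Proof.
move=> s0 Iv; have := @cvg_gamma_integral R s; rewrite Iv => /fine_cvg/= cs.
apply: (cvg_unique _ (@cvg_gamma_integral R (s + 1))) => //.
apply: cvg_EFin; first by near=> k.
rewrite -[X in _ --> X]add0r; under eq_cvg => k.
  rewrite /= gamma_integrand_by_parts; last 2 first.
  - by rewrite invr_gt0 ltr0n.
  - by rewrite (@lt_le_trans _ _ 1) ?ler1n// invf_lt1 ?ltr1n.
  over.
apply: cvgD; first exact: cvg_gamma_boundary.
exact: cvgMl_tmp.
Unshelve. all: by end_near. Qed.

Lemma gamma_integral1 (R : realType) :
  (\int[@lebesgue_measure R]_(x in `]0%R, +oo[) (gamma_integrand R 1 x)%:E = 1)%E.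
Proof.
rewrite integral_itv_obnd_cbnd; last first.
  by apply/measurable_EFinP; exact: measurable_gamma_integrand.
rewrite -(@integral_exponential_pdf R 1 ltr01) integral_mkcond.
apply: eq_integral => x _; rewrite /exponential_pdf !patchE; case: ifP => // _.
by rewrite /gamma_integrand subrr powRr0 !mul1r mulN1r.
Qed.

(** Substituting u = sqrt x turns exp(-u^2) du into exp(-x) / (2 sqrt x) dx. *)
Lemma sqrt_substitution (R : realType) (a b : R) : 0 < a -> a < b ->
  (\int[@lebesgue_measure R]_(x in `[a, b]) (gamma_integrand R (1 / 2) x) =
   2 * \int[@lebesgue_measure R]_(x in `[Num.sqrt a, Num.sqrt b]) gauss_fun x)%R.
Proof.
move=> a0 ab.
have D x : 0 < x -> (derive1 (@Num.sqrt R)) x = (2 * Num.sqrt x)^-1.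
  by move=> x0; rewrite derive1E; exact: derive_sqrt.
have cD x : 0 < x -> {for x, continuous (derive1 (@Num.sqrt R))}.
  move=> x0; have : {for x, continuous (fun x : R => (2 * Num.sqrt x)^-1)}.
    apply: cvgV; first by rewrite mulf_neq0// gt_eqF ?sqrtr_gt0.
    by apply: cvgMl_tmp; exact: sqrt_continuous.
  (* The formula [D] is available at positive points only, so continuity is transferred through
     equality near [x]. *)
  rewrite /prop_for /continuous_at D//; apply: cvg_trans; apply: near_eq_cvg.
  near=> y; rewrite D//; near: y; exact: lt_nbhsr.
have b0 := lt_trans a0 ab.
rewrite {2}/Rintegral integration_by_substitution_increasing; last first.
- by apply: continuous_subspaceT; exact: continuous_gauss_fun.
- apply: derivable_pos_itv; [move=> x x0|exact: a0|exact: ab].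
  exact: (@ex_derive _ _ _ _ _ _ _ (is_derive1_sqrt x0)).
- by apply: cvgP; apply: cvg_at_left_filter; exact: cD.
- by apply: cvgP; apply: cvg_at_right_filter; exact: cD.
- by move=> x; rewrite in_itv/= => /andP[ax _]; apply: cD; exact: lt_trans ax.
- move=> x y; rewrite !in_itv/= => /andP[ax _] /andP[ay _] xy.
  by rewrite ltr_sqrt// (lt_le_trans a0).
- exact: ltW.
rewrite -/(Rintegral _ _ _).
transitivity (2 * \int[@lebesgue_measure R]_(x in `[a, b])
    (2^-1 * gamma_integrand R (1 / 2) x))%R.
  rewrite RintegralZl//; first by rewrite mulrA divff ?mul1r.
  apply: continuous_compact_integrable; first exact: segment_compact.
  apply: derivable_oo_LRcontinuous_within; apply: derivable_pos_itv a0 ab.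
  by move=> x; exact: derivable_gamma_integrand.
congr (_ * _); apply: eq_Rintegral => x; rewrite inE/= in_itv/= => /andP[ax _].
have x0 := lt_le_trans a0 ax.
rewrite D// /gauss_fun /gamma_integrand sqr_sqrtr ?(ltW x0)//.
rewrite (_ : 1 / 2 - 1 = - 2^-1); last by field.
rewrite powRN powR12_sqrt ?(ltW x0)//; field.
by rewrite gt_eqF// sqrtr_gt0.
Unshelve. all: by end_near. Qed.

Lemma gamma_integral_half (R : realType) :
  (\int[@lebesgue_measure R]_(x in `]0%R, +oo[) (gamma_integrand R (1 / 2) x)%:E =
   (Num.sqrt pi)%:E)%E.
Proof.
have cg : (\int[@lebesgue_measure R]_(x in `[Num.sqrt k.+2%:R^-1, Num.sqrt k.+2%:R])
    (gauss_fun x)%:E)%E @[k --> \oo] --> (Num.sqrt pi / 2 : R)%:E.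
  rewrite -integral0y_gauss -integral_itv_obnd_cbnd; last first.
    by apply/measurable_EFinP; apply: measurable_funTS; exact: measurable_gauss_fun.
  apply: (@integral_pos_cvg R (@gauss_fun R) (fun k => Num.sqrt (k.+2%:R^-1))
    (fun k => Num.sqrt k.+2%:R)).
  - by apply: measurable_funTS; exact: measurable_gauss_fun.
  - by move=> x _; exact: gauss_fun_ge0.
  - by move=> k; rewrite sqrtr_gt0 invr_gt0 ltr0n.
  - by move=> i j ij; rewrite ler_sqrt ?invr_gt0// lef_pV2 ?posrE ?ltr0n// ler_nat !ltnS.
  - rewrite -[X in _ --> X]sqrtr0.
    exact: (continuous_cvg _ (@sqrt_continuous R 0) (@cvg_invr_natr2 R)).
  - by move=> i j ij; rewrite ler_sqrt ?ltr0n// ler_nat !ltnS.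
  - apply/cvgryPge => M; near=> k.
    rewrite (le_trans (ler_norm M))// -sqrtr_sqr ler_sqrt//.
    by near: k; move: (M ^+ 2); apply/cvgryPge; exact: cvg_natr2.
apply: (cvg_unique _ (@cvg_gamma_integral R (1 / 2))) => //.
apply: cvg_EFin; first by near=> k.
have -> : Num.sqrt pi = 2 * (Num.sqrt pi / 2) :> R by field.
move/fine_cvg in cg.
under eq_cvg => k.
  rewrite /= sqrt_substitution; last 2 first.
  - by rewrite invr_gt0 ltr0n.
  - by rewrite (@lt_le_trans _ _ 1) ?ler1n// invf_lt1 ?ltr1n.
  over.
exact: cvgMl_tmp.
Unshelve. all: by end_near. Qed.

(* AM-GM in the integrand: 2 sqrt x <= x / t + t. *)
Lemma gamma_integral_midpoint (R : realType) (s t u v w : R) :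
  0 < t ->
  (\int[@lebesgue_measure R]_(x in `]0%R, +oo[) (gamma_integrand R s x)%:E = u%:E)%E ->
  (\int[@lebesgue_measure R]_(x in `]0%R, +oo[) (gamma_integrand R (s + 1 / 2) x)%:E = v%:E)%E ->
  (\int[@lebesgue_measure R]_(x in `]0%R, +oo[) (gamma_integrand R (s + 1) x)%:E = w%:E)%E ->
  2 * v <= t^-1 * w + t * u.
Proof.
move=> t0 Iu Iv Iw; rewrite -lee_fin EFinD 3!EFinM -Iu -Iv -Iw.
have m r := @measurable_gamma_integrand R r `]0%R, +oo[.
have mE r : measurable_fun (`]0%R, +oo[ : set R) (fun x : R => (gamma_integrand R r x)%:E).
  by apply/measurable_EFinP.
have ig r A : (0 <= (gamma_integrand R r A)%:E)%E by rewrite lee_fin gamma_integrand_ge0.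
have cg c r x : 0 <= c -> (0 <= c%:E * (gamma_integrand R r x)%:E)%E.
  by move=> c0; apply: mule_ge0; rewrite lee_fin ?gamma_integrand_ge0.
have ti0 : 0 <= t^-1 by rewrite invr_ge0 ltW.
have tp0 := ltW t0.
have mC c r : measurable_fun (`]0%R, +oo[ : set R)
    (fun x : R => (c%:E * (gamma_integrand R r x)%:E)%E).
  by apply: emeasurable_funM; [exact: measurable_cst|exact: mE].
rewrite -!ge0_integralZl ?lee_fin//=; [|exact: mE..].
rewrite -ge0_integralD//=; [|by move=> x _; exact: cg|exact: mC
  |by move=> x _; exact: cg|exact: mC].
apply: ge0_le_integral => //=.
- by move=> x _; exact: cg.
- exact: mC.
- by apply: emeasurable_funD; exact: mC.
move=> x; rewrite in_itv/= andbT => x0.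
rewrite -!EFinM -EFinD lee_fin /gamma_integrand !mulrA -mulrDl.
apply: ler_wpM2r; first exact: expR_ge0.
have x0' : x != 0 by rewrite gt_eqF.
rewrite (_ : s + 1 / 2 - 1 = (s - 1) + 2^-1); last by field.
rewrite (_ : s + 1 - 1 = (s - 1) + 1); last by field.
rewrite !(@powRD _ x (s - 1)) ?x0' ?implybT// powR12_sqrt ?powRr1 ?(ltW x0)//.
have := powR_ge0 x (s - 1); have /esym := sqr_sqrtr (ltW x0).
move: (x `^ (s - 1)) (Num.sqrt x) => p r -> p0.
(* Here p = x^(s-1) and r = sqrt x, so the three integrands are p, p r and p r^2 up to the factor
   exp(-x), and the difference is a square. *)
rewrite -subr_ge0 (_ : _ - _ = p * (t^-1 * (r - t) ^+ 2)).
  by apply: mulr_ge0 => //; apply: mulr_ge0 => //; exact: sqr_ge0.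
by field; rewrite gt_eqF.
Qed.

(** * Values of Gamma and its growth over half a step *)

Lemma GammaE (R : realType) (s v : R) :
  (\int[@lebesgue_measure R]_(x in `]0%R, +oo[) (gamma_integrand R s x)%:E = v%:E)%E ->
  Gamma s = v.
Proof. by move=> Iv; rewrite /Gamma /Rintegral Iv. Qed.

Lemma gamma_integral_nat (R : realType) (n : nat) : (0 < n)%N ->
  (\int[@lebesgue_measure R]_(x in `]0%R, +oo[) (gamma_integrand R n%:R x)%:E =
   (n.-1`!%:R)%:E)%E.
Proof.
case: n => // n _; elim: n => [|n IH]; first exact: gamma_integral1.
by have := gamma_integralS _ _ _ _ IH; rewrite natr1 => ->//; rewrite factS natrM.
Qed.

Lemma gamma_integral_nat_half (R : realType) (n : nat) :
  (\int[@lebesgue_measure R]_(x in `]0%R, +oo[) (gamma_integrand R (n%:R + 1 / 2) x)%:E =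
   (Num.sqrt pi * \prod_(i < n) (i%:R + 1 / 2))%:E)%E.
Proof.
elim: n => [|n IH]; first by rewrite big_ord0 mulr1 add0r gamma_integral_half.
rewrite -natr1 addrAC (gamma_integralS _ _ _ _ IH) ?ltr_wpDl//.
by congr EFin; rewrite big_ord_recr/=; ring.
Qed.

(** The choice t = sqrt s balances the midpoint bound: the integral at s + 1 is s u, so both terms
    become sqrt s times u. *)
Lemma gamma_integral_logconvex (R : realType) (s u v : R) : 0 < s ->
  (\int[@lebesgue_measure R]_(x in `]0%R, +oo[) (gamma_integrand R s x)%:E = u%:E)%E ->
  (\int[@lebesgue_measure R]_(x in `]0%R, +oo[) (gamma_integrand R (s + 1 / 2) x)%:E = v%:E)%E ->
  v <= Num.sqrt s * u.
Proof.
move=> s0 Iu Iv; have t0 : 0 < Num.sqrt s by rewrite sqrtr_gt0.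
have := gamma_integral_midpoint _ _ _ _ _ _ t0 Iu Iv (gamma_integralS _ _ _ s0 Iu).
rewrite -[X in _ * (X * u)](sqr_sqrtr (ltW s0)) expr2 !mulrA mulVf ?gt_eqF// mul1r.
by rewrite -mulr2n mulr_natl ler_pMn2r.
Qed.

Lemma Gamma_half_le (R : realType) (n : nat) : (0 < n)%N ->
  Gamma (n%:R + 1 / 2 : R) <= Num.sqrt n%:R * Gamma (n%:R : R).
Proof.
move=> n0; have I1 := gamma_integral_nat R n n0; have I2 := gamma_integral_nat_half R n.
by rewrite (GammaE _ _ _ I1) (GammaE _ _ _ I2) (gamma_integral_logconvex _ _ _ _ _ I1 I2)// ltr0n.
Qed.

(** The half-step inequality started at n + 1/2, where it ends at Gamma(n + 1) = n Gamma(n). *)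
Lemma Gamma_half_ge (R : realType) (n : nat) : (0 < n)%N ->
  n%:R * Gamma (n%:R : R) <= Num.sqrt (n%:R + 1 / 2) * Gamma (n%:R + 1 / 2 : R).
Proof.
move=> n0; have n0' : 0 < n%:R :> R by rewrite ltr0n.
have I1 := gamma_integral_nat R n n0; have I2 := gamma_integral_nat_half R n.
have I3 := gamma_integralS _ _ _ n0' I1.
rewrite (GammaE _ _ _ I1) (GammaE _ _ _ I2).
apply: (gamma_integral_logconvex _ _ _ _ _ I2); first by rewrite addr_gt0.
by rewrite (_ : n%:R + 1 / 2 + 1 / 2 = n%:R + 1 :> R)//; field.
Qed.

(** * Records of permutations *)

(* Records are read from the right: position [a] is a record when its value
   exceeds all later ones. *)
Definition record (n : nat) (s : 'S_n) (a : 'I_n) : bool :=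
  [forall b : 'I_n, (a < b)%N ==> (s b < s a)%N].

Definition num_records (n : nat) (s : 'S_n) : nat := (\sum_(a < n) record n s a)%N.

Lemma record_lift0 (n : nat) (j : 'I_n.+1) (s : 'S_n) :
  record _ (lift_perm ord0 j s) ord0 = (j == ord_max).
Proof.
apply/forallP/eqP => [h|-> b]; last first.
  apply/implyP => b0; case: (unliftP ord0 b) b0 => [c ->|->//] _.
  by rewrite lift_perm_id lift_perm_lift lift_max.
apply/eqP/negPn/negP => jN; set p := lift_perm ord0 j s in h.
(* If position 0 does not take the largest value, then a later position does and refutes the
   record. *)
have max_p : (0 < (p^-1)%g ord_max)%N.
  rewrite lt0n; apply: contraNneq jN => E; have p0 : (p^-1)%g ord_max = ord0.
    exact: val_inj.
  by rewrite -[X in _ == X](permKV p) p0 lift_perm_id.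
have := h ((p^-1)%g ord_max).
by rewrite /= max_p permKV /p lift_perm_id /= ltnNge -ltnS ltn_ord.
Qed.

Lemma record_lift (n : nat) (j : 'I_n.+1) (s : 'S_n) (a : 'I_n) :
  record _ (lift_perm ord0 j s) (lift ord0 a) = record _ s a.
Proof.
have lift_lt (i : 'I_n.+1) (c d : 'I_n) : (lift i c < lift i d)%N = (c < d)%N.
  by rewrite /= /bump; case: leqP; case: leqP => ? ?; rewrite ?add1n ?add0n; lia.
apply/forallP/forallP => h b.
  by have := h (lift ord0 b); rewrite !lift_perm_lift !lift_lt.
case: (unliftP ord0 b) => [c ->|->//].
by rewrite !lift_perm_lift !lift_lt; exact: h.
Qed.

(* Prepending a position leaves the later records alone and adds a record only
   when it takes the largest value. *)
Lemma num_records_lift (n : nat) (j : 'I_n.+1) (s : 'S_n) :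
  num_records _ (lift_perm ord0 j s) = ((j == ord_max) + num_records _ s)%N.
Proof.
rewrite /num_records big_ord_recl record_lift0; congr (_ + _)%N.
by apply: eq_bigr => a _; rewrite record_lift.
Qed.

(** A permutation of n + 1 points is its value at 0 together with a permutation of the rest.
    Injectivity and the count (n+1)! make this a bijection. *)
Lemma sum_perm_recl (R : nmodType) (n : nat) (F : 'S_n.+1 -> R) :
  \sum_s F s = \sum_(j < n.+1) \sum_(s : 'S_n) F (lift_perm ord0 j s).
Proof.
rewrite pair_big/= (reindex (fun p : 'I_n.+1 * 'S_n => lift_perm ord0 p.1 p.2))//=.
apply: onW_bij; apply: inj_card_bij; last by rewrite card_prod !card_Sn card_ord factS.
move=> [j s] [k t] /= /permP E.
have jk : j = k by have := E ord0; rewrite !lift_perm_id.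
congr (_, _) => //; apply/permP => i; have := E (lift ord0 i).
by rewrite !lift_perm_lift jk => /lift_inj.
Qed.

(** Of the n + 1 values for the prepended position, the largest adds a record and the other n add
    none. *)
Lemma sum_num_recordsS (R : nmodType) (n : nat) (F : nat -> R) :
  \sum_(s : 'S_n.+1) F (num_records _ s) =
  \sum_(s : 'S_n) (F (num_records _ s).+1 + F (num_records _ s) *+ n).
Proof.
rewrite sum_perm_recl exchange_big; apply: eq_bigr => s _.
rewrite (bigD1 ord_max)//= num_records_lift eqxx; congr (_ + _).
rewrite (eq_bigr (fun=> F (num_records _ s))); last first.
  by move=> j /negbTE jN; rewrite num_records_lift jN.
by rewrite sumr_const (cardC1 (ord_max : 'I_n.+1)) card_ord.
Qed.

Lemma num_records_gt0 (n : nat) (s : 'S_n) : (0 < n)%N -> (0 < num_records _ s)%N.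
Proof.
case: n s => // n s _; rewrite /num_records (bigD1 ord_max)//= ltn_addr// lt0b.
by apply/forallP => b; rewrite ltnNge -ltnS ltn_ord.
Qed.

(** The rising factorial is the generating function of record counts: prepending a position
    multiplies the sum by x + n. *)
Lemma sum_expr_num_records (R : comRingType) (n : nat) (x : R) :
  \sum_(s : 'S_n) x ^+ num_records _ s = \prod_(i < n) (x + i%:R).
Proof.
elim: n => [|n IH].
  rewrite big_ord0 (eq_bigr (fun=> 1)) ?sumr_const ?card_Sn//.
  by move=> s _; rewrite /num_records big_ord0.
rewrite sum_num_recordsS big_ord_recr/= -IH mulr_suml; apply: eq_bigr => s _.
by rewrite exprSr mulrDr mulr_natr.
Qed.

Lemma card_num_records1 (n : nat) : (0 < n)%N ->
  (\sum_(s : 'S_n) (num_records _ s == 1) = n.-1`!)%N.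
Proof.
elim: n => // -[_ _|n IH _].
  rewrite (eq_bigr (fun=> 1%N)) ?sum1_card ?card_Sn// => s _.
  by rewrite eqn_leq num_records_gt0 ?andbT// /num_records big_ord_recl big_ord0 addn0 leq_b1.
rewrite (sum_num_recordsS nat _ (fun k => (k == 1) : nat)) -[RHS]/(n.+1 * n`!)%N -IH// big_distrr/=.
apply: eq_bigr => s _.
(* The shorter permutation already has a record, so a prepended largest value would make at least
   two. *)
rewrite eqSS eqn0Ngt num_records_gt0// add0r.
have natE (a k : nat) : a *+ k = (k * a)%N by elim: k => // k IHk; rewrite mulrS IHk mulSn.
exact: natE.
Qed.

(** * Elimination with two rows *)

Lemma undominatedE (m n : nat) (A B : 'M[nat]_(m, n)) (s : subgame m n) :
  undominated A B s = (eliminate A B s == s).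
Proof.
case: s => Y X; rewrite /undominated /eliminate xpair_eqE /=.
have fixE (T : finType) (Z : {set T}) (p : pred T) :
    [forall i in Z, ~~ p i] = (finset (fun i => (i \in Z) && ~~ p i) == Z).
  apply/forall_inP/eqP => [h|<- i]; last by rewrite inE => /andP[].
  by apply/setP => i; rewrite inE; case iZ : (i \in Z) => //=; exact: h.
by rewrite !fixE.
Qed.

Lemma after_roundsS (m n : nat) (A B : 'M[nat]_(m, n)) (k : nat) :
  after_rounds A B k.+1 = eliminate A B (after_rounds A B k).
Proof. by []. Qed.

Lemma after_rounds_stable (m n : nat) (A B : 'M[nat]_(m, n)) (j k : nat) :
  undominated A B (after_rounds A B j) -> (j <= k)%N ->
  after_rounds A B k = after_rounds A B j.
Proof.
move=> uj jk; rewrite -(subnK jk).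
elim: (k - j)%N => // i IHi; rewrite addSn after_roundsS IHi.
by apply/eqP; rewrite -undominatedE.
Qed.

Lemma iterationsP (m n : nat) (A B : 'M[nat]_(m, n)) (k : nat) :
  undominated A B (after_rounds A B k) ->
  (iterations A B <= k)%N /\
  after_rounds A B (iterations A B) = after_rounds A B k.
Proof.
move=> uk; rewrite /iterations; case: ex_minnP => j uj jmin.
have jk := jmin _ uk; split=> //.
by apply/esym; exact: after_rounds_stable.
Qed.

(** Only the last round has to be seen to delete something: stopping at any earlier time would make
    rounds [k] and [k.+1] coincide. *)
Lemma iterations_eq (m n : nat) (A B : 'M[nat]_(m, n)) (k : nat) :
  undominated A B (after_rounds A B k.+1) ->
  after_rounds A B k.+1 != after_rounds A B k ->
  iterations A B = k.+1.
Proof.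
move=> uk neq; have [ik _] := iterationsP _ _ _ _ _ uk.
apply/eqP; rewrite eqn_leq ik ltnNge; apply: contra neq => ik'.
have [j jk uj] : exists2 j, (j <= k)%N & undominated A B (after_rounds A B j).
  by exists (iterations A B) => //; rewrite /iterations; case: ex_minnP.
rewrite after_roundsS -undominatedE.
by rewrite (after_rounds_stable _ _ _ _ _ _ uj jk).
Qed.

Section TwoRows.
Variables (n : nat) (g : game 2 n).
Local Notation A := (row_payoff g).
Local Notation B := (col_payoff g).
Implicit Type X : {set 'I_n}.

(** With two rows, the place of the top payoff determines the whole permutation of column [j]. *)
Definition preferred_row (j : 'I_n) : 'I_2 := ((g.1 j)^-1)%g ord_max.

Definition agree X : bool := [exists i, [forall j in X, preferred_row j == i]].

Definition maximal_cols : {set 'I_n} :=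
  finset (fun j => ~~ col_dominated B (finset.setT, finset.setT) j).

Lemma row_payoff_lt (i i' : 'I_2) (j : 'I_n) : i != i' ->
  (A i j < A i' j)%N = (preferred_row j != i).
Proof.
move=> ii'; rewrite !mxE ltnS /preferred_row.
have ne : g.1 j i != g.1 j i' by rewrite (inj_eq perm_inj).
have -> : ((g.1 j)^-1%g ord_max != i) = (g.1 j i != ord_max).
  by rewrite eq_sym -(inj_eq (@perm_inj _ (g.1 j))) permKV.
by move: (g.1 j i) (g.1 j i') ne => [[|[]]//= ?] [[|[]]//= ?].
Qed.

(** The only possible dominator of a row is the other one. *)
Lemma row_dominatedT X (i : 'I_2) :
  row_dominated A (finset.setT, X) i = [forall j in X, preferred_row j != i].
Proof.
apply/existsP/forall_inP => /= [[i' /andP[_ /forall_inP h]] j jX|h].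
  have [ii'|ne] := eqVneq i i'; first by have := h j jX; rewrite ii' ltnn.
  by rewrite -(row_payoff_lt _ _ _ ne) h.
have [i' ne] : exists i', i != i' by exists (rev_ord i); case: i {h} => [[|[]]].
exists i'; rewrite inE /=; apply/forall_inP => j /h; by rewrite (row_payoff_lt _ _ _ ne).
Qed.

Lemma eliminate_agree X i : X != finset.set0 ->
  (forall j, j \in X -> preferred_row j = i) ->
  (eliminate A B (finset.setT, X)).1 = finset.set1 i.
Proof.
move=> /set0Pn[j0 j0X] h; apply/setP => k; rewrite /eliminate !inE /= row_dominatedT.
have [->|ne] := eqVneq k i.
  by apply/negP => /forall_inP/(_ _ j0X)/eqP; apply; exact: h.
by apply/negbTE; rewrite negbK; apply/forall_inP => j /h ->; rewrite eq_sym.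
Qed.

Lemma eliminate_disagree X : ~~ agree X ->
  (eliminate A B (finset.setT, X)).1 = finset.setT.
Proof.
move=> /existsPn h; apply/setP => k; rewrite /eliminate !inE /= row_dominatedT.
(* [rev_ord] swaps the two rows; a dominated row [k] would yield a column preferring neither of
   them. *)
apply/negP => /forall_inP hk; have /forall_inPn[] := h (rev_ord k).
move=> j jX /negP; apply; have := hk j jX.
by move: (preferred_row j) k {h hk} => [[|[]]//= ?] [[|[]]//= ?].
Qed.

Lemma eliminate_maximal : (eliminate A B (finset.setT, finset.setT)).2 = maximal_cols.
Proof. by apply/setP => j; rewrite !inE. Qed.

(** While both rows remain, domination between two columns does not depend on the other columns
    present, so nothing new becomes dominated. *)
Lemma eliminate_maximal_cols : (eliminate A B (finset.setT, maximal_cols)).2 = maximal_cols.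
Proof.
apply/setP => j; rewrite !inE /=; apply: andb_idr; apply: contra.
move=> /existsP[j' /andP[_ h]]; apply/existsP; exists j'; by rewrite inE.
Qed.

(** Against a single row Column's payoffs are distinct, so the best column in [X] strictly dominates
    the others. *)
Lemma eliminate_set1 i X : X != finset.set0 ->
  exists j, eliminate A B (finset.set1 i, X) = (finset.set1 i, finset.set1 j).
Proof.
move=> /set0Pn[j0 j0X]; pose j := [arg max_(k > j0 in X) (g.2 i k : nat)].
have [jX jmax] : j \in X /\ forall k, k \in X -> (g.2 i k <= g.2 i j)%N.
  by rewrite /j; case: arg_maxnP.
exists j; rewrite /eliminate; congr (_, _); apply/setP => k; rewrite !inE /=.
  have [->|//] := eqVneq k i; apply/negP => /existsP[i' /andP[]].
  by rewrite inE => /eqP -> /forall_inP/(_ _ j0X); rewrite ltnn.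
have [->|ne] := eqVneq k j.
  rewrite jX; apply/negP => /existsP[j' /andP[j'X /forall_inP/(_ i)]].
  by rewrite inE eqxx !mxE => /(_ isT); rewrite ltnS ltnNge jmax.
case kX : (k \in X) => //=; apply/negbTE; rewrite negbK; apply/existsP; exists j.
rewrite jX; apply/forall_inP => y; rewrite inE => /eqP ->; rewrite !mxE ltnS.
by rewrite ltn_neqAle jmax// andbT (inj_eq val_inj) (inj_eq perm_inj).
Qed.

Hypothesis n_gt0 : (0 < n)%N.

Lemma maximal_cols_neq0 : maximal_cols != finset.set0.
Proof.
pose j := [arg max_(k > Ordinal n_gt0) (g.2 ord0 k : nat)].
have jmax k : (g.2 ord0 k <= g.2 ord0 j)%N by rewrite /j; case: arg_maxnP => // ? _; apply.
apply/set0Pn; exists j; rewrite inE; apply/negP => /existsP[k /andP[_]].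
by move=> /forall_inP/(_ ord0); rewrite inE => /(_ isT); rewrite !mxE ltnS ltnNge jmax.
Qed.

Lemma agree_sub (X Y : {set 'I_n}) : X \subset Y -> agree Y -> agree X.
Proof.
move=> /fintype.subsetP XY /existsP[i /forall_inP h]; apply/existsP; exists i.
by apply/forall_inP => j /XY; exact: h.
Qed.

Lemma agree_card1 (X : {set 'I_n}) : #|X| == 1%N -> agree X.
Proof.
move=> /cards1P[j ->]; apply/existsP; exists (preferred_row j).
by apply/forall_inP => k; rewrite inE => /eqP ->.
Qed.

Lemma eliminate_sub1 (s : subgame 2 n) : (eliminate A B s).2 \subset s.2.
Proof. by apply/fintype.subsetP => j; rewrite inE => /andP[]. Qed.

Lemma set1_neq_setT2 (i : 'I_2) : finset.set1 i != finset.setT.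
Proof. by apply/eqP => /(congr1 (fun Z : {set 'I_2} => #|Z|)); rewrite cards1 cardsT card_ord. Qed.

(** The full course of a solvable game has three rounds: nonmaximal columns go, then a row, then all
    remaining columns but one. Agreement on all columns moves the deletion of the row into the first
    round, and a single maximal column makes the last round void; each saves one round. *)
Lemma game_outcome :
  if agree maximal_cols then
    game_solvable g /\
    (game_iterations g + agree finset.setT + (#|maximal_cols| == 1) = 3)%N
  else ~~ game_solvable g.
Proof.
have M0 := maximal_cols_neq0.
have AM (i : 'I_2) (j : 'I_n) :
    eliminate A B (finset.set1 i, finset.set1 j) = (finset.set1 i, finset.set1 j).
  have [|k E] := eliminate_set1 i (finset.set1 j).
    by apply/set0Pn; exists j; rewrite inE.
  rewrite E; congr (_, _); have := eliminate_sub1 (finset.set1 i, finset.set1 j).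
  by rewrite E finset.sub1set inE => /eqP ->.
(* The round that picks the best column changes nothing exactly when only one column was left. *)
have cardE (i : 'I_2) (j : 'I_n) :
    eliminate A B (finset.set1 i, maximal_cols) = (finset.set1 i, finset.set1 j) ->
    ((finset.set1 i, finset.set1 j) == (finset.set1 i, maximal_cols)) = (#|maximal_cols| == 1%N).
  move=> E; rewrite xpair_eqE eqxx /=; apply/eqP/cards1P => [<-|[k Mk]]; first by exists j.
  have := eliminate_sub1 (finset.set1 i, maximal_cols).
  by rewrite E Mk finset.sub1set inE => /eqP ->.
have T1 : after_rounds A B 1 = ((eliminate A B (finset.setT, finset.setT)).1, maximal_cols).
  by rewrite -eliminate_maximal -surjective_pairing.
have T0 : (finset.setT : {set 'I_n}) != finset.set0.
  by apply/set0Pn; exists (Ordinal n_gt0).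
case: ifPn => [aM|naM].
  have [i hi] := existsP aM; have [j Ej] := eliminate_set1 i _ M0.
  have [aT|naT] := boolP (agree finset.setT).
    have E1 : after_rounds A B 1 = (finset.set1 i, maximal_cols).
      rewrite T1; have [k hk] := existsP aT.
      (* The row agreed on over the maximal columns and the one agreed on over all columns coincide
         at any maximal column. *)
      have -> : i = k.
        have [l lM] := set0Pn _ M0; rewrite -(eqP (forall_inP hi l lM)).
        by apply/eqP; apply: (forall_inP hk); rewrite inE.
      by rewrite (eliminate_agree _ k)// => l _; apply/eqP; apply: (forall_inP hk); rewrite inE.
    have E2 : after_rounds A B 2 = (finset.set1 i, finset.set1 j).
      by rewrite after_roundsS E1.
    have u2 : undominated A B (after_rounds A B 2) by rewrite E2 undominatedE AM.
    have neq0 : after_rounds A B 1 != after_rounds A B 0.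
      by rewrite E1 xpair_eqE negb_and set1_neq_setT2.
    split.
      rewrite /game_solvable /dominance_solvable; have [_ ->] := iterationsP _ _ _ _ _ u2.
      by rewrite E2 /= !cards1.
    have := cardE _ _ Ej; rewrite -E2 -E1; case: eqP => [E21|/eqP E21] <-.
      have it1 : game_iterations g = 1%N.
        by apply: (iterations_eq _ _ _ _ 0 _ neq0); rewrite -E21.
      by rewrite it1.
    by have -> : game_iterations g = 2%N by exact: (iterations_eq _ _ _ _ 1 u2 E21).
  have E1 : after_rounds A B 1 = (finset.setT, maximal_cols).
    by rewrite T1 eliminate_disagree.
  have E2 : after_rounds A B 2 = (finset.set1 i, maximal_cols).
    rewrite after_roundsS E1.
    rewrite [LHS]surjective_pairing eliminate_maximal_cols (eliminate_agree _ i)//.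
    by move=> k kM; apply/eqP; exact: (forall_inP hi).
  have E3 : after_rounds A B 3 = (finset.set1 i, finset.set1 j).
    by rewrite after_roundsS E2.
  have u3 : undominated A B (after_rounds A B 3) by rewrite E3 undominatedE AM.
  have neq1 : after_rounds A B 2 != after_rounds A B 1.
    by rewrite E1 E2 xpair_eqE negb_and set1_neq_setT2.
  split.
    rewrite /game_solvable /dominance_solvable; have [_ ->] := iterationsP _ _ _ _ _ u3.
    by rewrite E3 /= !cards1.
  have := cardE _ _ Ej; rewrite -E3 -E2; case: eqP => [E32|/eqP E32] <-.
    have it2 : game_iterations g = 2%N.
      by apply: (iterations_eq _ _ _ _ 1 _ neq1); rewrite -E32.
    by rewrite it2.
  by have -> : game_iterations g = 3%N by exact: (iterations_eq _ _ _ _ 2 u3 E32).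
(* Disagreement on the maximal columns is disagreement on all columns, so both rows survive the
   first round and elimination is stuck. *)
have E1 : after_rounds A B 1 = (finset.setT, maximal_cols).
  rewrite T1 eliminate_disagree//; apply: contra naM; exact: agree_sub (finset.subsetT _).
have u1 : undominated A B (after_rounds A B 1).
  rewrite E1 undominatedE [X in X == _]surjective_pairing.
  by rewrite eliminate_maximal_cols eliminate_disagree.
rewrite /game_solvable /dominance_solvable; have [_ ->] := iterationsP _ _ _ _ _ u1.
by rewrite E1 /= cardsT card_ord.
Qed.

End TwoRows.

(** * Probabilities *)

(* List the columns by increasing payoff in the first row: the maximal ones are
   the records of the second row. *)
Lemma card_maximal_cols (n : nat) (g : game 2 n) :
  #|maximal_cols n g| = num_records n ((g.2 ord0)^-1 * g.2 ord_max)%g.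
Proof.
rewrite /num_records -sum1_card big_mkcond/=.
rewrite (reindex_inj (@perm_inj _ ((g.2 ord0)^-1)%g))/=.
apply: eq_bigr => a _; rewrite inE; congr nat_of_bool.
apply/existsPn/forallP => h b.
- apply/implyP => ab; have := h (((g.2 ord0)^-1)%g b); rewrite inE /=.
  move=> /forall_inPn[y _]; rewrite !mxE ltnS !permM.
  have [->|] := eqVneq y ord0; first by rewrite !permKV ab.
  case: y => -[//|[|//]] y2 _; rewrite (_ : Ordinal y2 = ord_max); last exact: val_inj.
  rewrite -leqNgt leq_eqVlt => /predU1P[/val_inj/perm_inj/perm_inj E|//].
  by rewrite E ltnn in ab.
- rewrite inE /=; apply/negP => /forall_inP hd.
  have := h (g.2 ord0 b); have := hd ord0; have := hd ord_max.
  rewrite !inE !mxE !ltnS !permM permKV permK.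
  by move=> /(_ isT) h1 /(_ isT) -> /=; rewrite ltnNge ltnW.
Qed.

(** The map (s, t) to (s, s t) is a bijection on pairs, so the quotient of two independent uniform
    permutations is again uniform. *)
Lemma sum_pairs_of_perms (R : nmodType) (n : nat) (F : 'S_n -> R) :
  \sum_(h : {ffun 'I_2 -> 'S_n}) F ((h ord0)^-1 * h ord_max)%g =
  (\sum_s F s) *+ n`!.
Proof.
pose pr (p : 'S_n * 'S_n) : {ffun 'I_2 -> 'S_n} :=
  [ffun i => if i == ord0 then p.1 else (p.1 * p.2)%g].
rewrite (reindex pr)/=; last first.
  exists (fun h => (h ord0, ((h ord0)^-1 * h ord_max)%g)) => [[s t] _|h _] /=.
    by rewrite !ffunE /= mulKg.
  apply/ffunP => i; rewrite ffunE /= mulKVg; have [->//|] := eqVneq i ord0.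
  by case: i => -[//|[|//]] i2 _; congr (h _); exact: val_inj.
rewrite (eq_bigr (fun p => F p.2)); last by move=> p _; rewrite !ffunE /= mulKg.
rewrite -(pair_big xpredT xpredT (fun _ t => F t))/= sumr_const.
by rewrite card_Sn.
Qed.

Lemma sum_S2_inv_max (R : pzSemiRingType) (i : 'I_2) :
  \sum_(p : 'S_2) ((p^-1)%g ord_max == i)%:R = 1 :> R.
Proof.
rewrite (eq_bigr (fun p : 'S_2 => (p i == ord_max)%:R)); last first.
  by move=> p _; rewrite -(inj_eq (@perm_inj _ p)) permKV eq_sym.
rewrite sum_perm_recl (eq_bigr (fun j => (if i == ord0 then j == ord_max else j == ord0)%:R)).
  by rewrite !big_ord_recl big_ord0 /=; case: eqP => _; rewrite /= ?addr0 ?add0r.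
move=> j _; rewrite (eq_bigr (fun=> (if i == ord0 then j == ord_max else j == ord0)%:R)).
  by rewrite sumr_const card_Sn.
move=> s _; congr (nat_of_bool _)%:R.
case: (unliftP ord0 i) => [k ->|->]; last by rewrite lift_perm_id.
rewrite lift_perm_lift [s k]ord1 [k]ord1.
by case: j => -[|[]].
Qed.

(** Choose the common row in 2 ways; the columns in [X] are then forced and each other column is
    free. Nonemptiness of [X] keeps an outcome from being counted for both rows. *)
Lemma sum_agree (R : comPzSemiRingType) (n : nat) (h : {ffun 'I_2 -> 'S_n}) (X : {set 'I_n}) :
  X != finset.set0 ->
  \sum_(f : {ffun 'I_n -> 'S_2}) (agree n (f, h) X)%:R = 2 ^+ (n - #|X|).+1 :> R.
Proof.
move=> /set0Pn[j0 j0X].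
(* The product of [F i j] over [j] is the indicator that row [i] is preferred throughout [X], so the
   sum over permutations factors column by column. *)
pose F i j (p : 'S_2) : R := if j \in X then ((p^-1)%g ord_max == i)%:R else 1.
transitivity (\sum_(f : {ffun 'I_n -> 'S_2}) \sum_(i < 2) \prod_j F i j (f j)).
  apply: eq_bigr => f _.
  have [/existsP[i /forall_inP hi]|/existsPn nag] := boolP (agree _ _ _).
    have Fi : \prod_j F i j (f j) = 1.
      by apply: big1 => j _; rewrite /F; case: ifP => // jX; rewrite hi.
    rewrite (bigD1 i)//= Fi big1 ?addr0// => k ki.
     rewrite (bigD1 j0)//= /F j0X.
    have /eqP := hi _ j0X; rewrite /preferred_row /= => ->.
    by rewrite eq_sym (negbTE ki) mul0r.
  rewrite big1// => i _; have /forall_inPn[j jX nj] := nag i.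
  by rewrite (bigD1 j)//= /F jX (negbTE nj) mul0r.
rewrite exchange_big /= (eq_bigr (fun=> 2 ^+ (n - #|X|))); last first.
  move=> i _; rewrite -(bigA_distr_bigA (F i)) (bigID (mem X))/=.
  rewrite big1 ?mul1r; last first.
    by move=> j jX; rewrite -[RHS](sum_S2_inv_max R i); apply: eq_bigr => p _; rewrite /F jX.
  rewrite (eq_bigr (fun=> 2)); last first.
    move=> j /negbTE jX; rewrite (eq_bigr (fun=> 1)) ?sumr_const ?card_Sn// => p _.
    by rewrite /F jX.
  rewrite prodr_const; congr (_ ^+ _).
  by have /(congr1 (subn^~ #|X|)) := cardC (mem X); rewrite addKn card_ord => <-; exact: eq_card.
by rewrite sumr_const card_ord exprS mulr_natl.
Qed.

(** Column's payoffs [h] are summed outermost: the maximal columns depend on [h] alone, so Row's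
    payoffs can be counted with these columns fixed. *)
Lemma game_probE (R : realType) (n : nat) (E : pred (game 2 n)) :
  game_prob R E = (2 ^+ n * n`!%:R ^+ 2)^-1 *
    \sum_(h : {ffun 'I_2 -> 'S_n}) \sum_(f : {ffun 'I_n -> 'S_2}) (E (f, h))%:R.
Proof.
rewrite /game_prob /game_mass !prodr_const !card_ord.
rewrite sumr_const -[_ *+ _]mulr_natr !exprVn -invfM; congr (_ * _).
rewrite -sum1_card natr_sum big_mkcond exchange_big pair_big/=.
by apply: eq_bigr => -[f h] _; rewrite unfold_in; case: (E _).
Qed.

Section Counting.
Variables (R : realType) (n : nat).
Hypothesis n_gt0 : (0 < n)%N.

Lemma prob_all_agree : game_prob R (fun g : game 2 n => agree n g finset.setT) = 2 / 2 ^+ n.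
Proof.
rewrite game_probE (eq_bigr (fun=> 2)) => [|h _]; last first.
  rewrite sum_agree ?cardsT ?card_ord ?subnn//.
  by apply/set0Pn; exists (Ordinal n_gt0); rewrite inE.
rewrite sumr_const card_ffun card_Sn card_ord -(mulr_natr 2) natrX.
field; rewrite expf_neq0 ?pnatr_eq0//=.
by rewrite -lt0n fact_gt0.
Qed.

Lemma prob_one_maximal : game_prob R (fun g : game 2 n => #|maximal_cols n g| == 1%N) = n%:R^-1.
Proof.
rewrite game_probE (eq_bigr (fun h : {ffun 'I_2 -> 'S_n} =>
    2 ^+ n * (num_records n ((h ord0)^-1 * h ord_max)%g == 1%N)%:R)) => [|h _]; last first.
  rewrite (eq_bigr (fun=> (num_records n ((h ord0)^-1 * h ord_max)%g == 1%N)%:R)).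
    by rewrite sumr_const card_ffun card_Sn card_ord -(mulr_natr _ (2 ^ n)) natrX mulrC.
  by move=> f _; rewrite card_maximal_cols.
rewrite -big_distrr/= (sum_pairs_of_perms R n (fun s => (num_records n s == 1%N)%:R)).
rewrite -natr_sum card_num_records1// -(mulr_natr _ n`!).
rewrite -(prednK n_gt0) /= factS natrM; field.
by rewrite expf_neq0 ?pnatr_eq0//= nat1r !pnatr_eq0 -!lt0n fact_gt0.
Qed.

(** Given [h] with K maximal columns, 2^(n-K+1) of Row's outcomes are solvable; summing 2^(-K) is
    the record generating function at 1/2. *)
Lemma prob_solvable :
  game_prob R (@game_solvable 2 n) = 2 * (\prod_(i < n) (i%:R + 1 / 2)) / n`!%:R.
Proof.
rewrite game_probE (eq_bigr (fun h : {ffun 'I_2 -> 'S_n} =>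
    2 ^+ n.+1 * 2^-1 ^+ (num_records n ((h ord0)^-1 * h ord_max)%g))) => [|h _]; last first.
  rewrite (eq_bigr (fun f => (agree n (f, h) (maximal_cols n (f, h)))%:R)); last first.
    by move=> f _; have := game_outcome n (f, h) n_gt0; case: ifP => _ => [[->]|/negbTE->].
  (* An arbitrary [f0] in place of [f] makes the independence of the maximal columns from Row's
     payoffs visible. *)
  have [f0 _] : exists f0 : {ffun 'I_n -> 'S_2}, True by exists [ffun=> 1%g].
  rewrite (eq_bigr (fun f => (agree n (f, h) (maximal_cols n (f0, h)))%:R))//.
  rewrite sum_agree ?maximal_cols_neq0// -[in RHS]/((f0, h).2) -card_maximal_cols.
  have pow2 (m : nat) : (m <= n)%N -> 2 ^+ (n - m).+1 = 2 ^+ n.+1 * 2^-1 ^+ m :> R.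
    by move=> mn; rewrite exprVn -subSn// expfB_cond// pnatr_eq0 leqW.
  by apply: pow2; rewrite -[X in (_ <= X)%N]card_ord max_card.
rewrite -big_distrr/= (sum_pairs_of_perms R n (fun s => 2^-1 ^+ num_records n s)).
under [in RHS]eq_bigr do rewrite addrC div1r.
rewrite sum_expr_num_records; move: (\prod_(i < n) _) => p.
rewrite -(mulr_natr p) (exprS _ n); field; rewrite expf_neq0 ?pnatr_eq0//=.
by rewrite -lt0n fact_gt0.
Qed.

Lemma prob_solvable_gt0 : 0 < game_prob R (@game_solvable 2 n).
Proof.
rewrite prob_solvable divr_gt0 ?ltr0n ?fact_gt0// mulr_gt0//.
by apply: prodr_gt0 => i _; rewrite ltr_wpDl.
Qed.

Lemma sum_prob_iterations :
  \sum_(k < 4) game_prob R (fun g : game 2 n => (game_iterations g == k) && game_solvable g)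
  = game_prob R (@game_solvable 2 n).
Proof.
rewrite /game_prob (exchange_big_dep (@game_solvable 2 n))/=; last by move=> k g _ /andP[].
apply: eq_bigr => g sg; have := game_outcome n g n_gt0; case: ifP => _; last by rewrite sg.
move=> [_ E]; have it4 : (game_iterations g < 4)%N by rewrite ltnS -E -addnA leq_addr.
rewrite (big_pred1 (Ordinal it4))// => k; rewrite sg andbT /=.
by rewrite eq_sym.
Qed.

(** Both correction events imply solvability, so their unconditional probabilities may be
    subtracted. At most three rounds occur, hence the range of [k]. *)
Lemma mean_iterations :
  \sum_(k < 4) k%:R * game_prob R (fun g : game 2 n => (game_iterations g == k) && game_solvable g)
  = 3 * game_prob R (@game_solvable 2 n) - 2 / 2 ^+ n - n%:R^-1.
Proof.
rewrite -prob_all_agree -prob_one_maximal.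
have iterationsE (g : game 2 n) : game_solvable g ->
    (game_iterations g + agree n g finset.setT + (#|maximal_cols n g| == 1) = 3)%N.
  by have := game_outcome n g n_gt0; case: ifP => [_ []//|_ /negbTE ->].
have restrict (E : pred (game 2 n)) : (forall g, E g -> game_solvable g) ->
    game_prob R E = \sum_(g : game 2 n | game_solvable g) (E g)%:R * game_mass R g.
  move=> Esub; rewrite /game_prob big_mkcond [RHS]big_mkcond; apply: eq_bigr => g _.
  by case: ifP => [/Esub->|_]; rewrite ?mul1r//; case: ifP => // _; rewrite mul0r.
rewrite [in RHS](restrict (fun g => agree n g finset.setT)); last first.
  move=> g aT; have := game_outcome n g n_gt0.
  by rewrite (agree_sub _ _ _ _ (finset.subsetT _) aT) => -[].
rewrite [in RHS](restrict (fun g => #|maximal_cols n g| == 1%N)); last first.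
  move=> g M1; have := game_outcome n g n_gt0.
  by rewrite (agree_card1 _ _ _ M1) => -[].
rewrite /game_prob big_distrr/= -!sumrB.
under eq_bigr do rewrite big_distrr/=.
rewrite (exchange_big_dep (@game_solvable 2 n))/=; last by move=> k g _ /andP[].
apply: eq_bigr => g sg; have E := iterationsE g sg.
have it4 : (game_iterations g < 4)%N by rewrite ltnS -E -addnA leq_addr.
rewrite (big_pred1 (Ordinal it4)) => [/=|k]; last by rewrite sg andbT eq_sym.
rewrite -!mulrBl; congr (_ * _).
by rewrite -[3]/(3%:R) -E !natrD; ring.
Qed.

End Counting.

(** * Expected number of iterations *)

(** The atoms below [N] carry total mass 1, so [X] agrees almost everywhere with a finite
    combination of indicators. *)
Lemma expectation_nat_valued (R : realType) (d : measure_display)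
    (T : measurableType d) (P : probability T R) (X : {RV P >-> R})
    (N : nat) (p : nat -> R) :
  (forall k, P (X @^-1` [set k%:R]) = (p k)%:E) ->
  \sum_(k < N) p k = 1 ->
  ('E_P[X] = (\sum_(k < N) k%:R * p k)%:E)%E.
Proof.
move=> pX p1; pose A (k : nat) := X @^-1` [set k%:R : R].
have mA k : measurable (A k) by rewrite /A -[_ @^-1` _]setTI; exact: measurable_funP.
have tA : trivIset setT A.
  by move=> i j _ _ [t [/= Xi Xj]]; apply/eqP; rewrite -(eqr_nat R) -Xi -Xj.
pose U := \big[setU/set0]_(k < N) A k.
have mU : measurable U by exact: bigsetU_measurable.
have PU : P U = 1%E.
  rewrite /U measure_bigsetU// -[RHS]/(1%:E) -p1 -sumEFin.
  by apply: eq_bigr => k _; exact: pX.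
have PUC : P (~` U) = 0%E by rewrite probability_setC// PU subee.
have aeX : ae_eq P setT (EFin \o X) (fun x => \sum_(k < N) (k%:R * \1_(A k) x)%:E)%E.
  exists (~` U); split; [exact: measurableC|exact: PUC|].
  apply: subsetC => t Ut _ /=.
  move: Ut; rewrite /U -bigcup_mkord => -[k /= kN Akt].
  rewrite (bigD1 (Ordinal kN))//= indicE mem_set// mulr1 big1 ?adde0.
    by rewrite Akt.
  move=> i ik; rewrite indicE memNset ?mulr0// => Ait; move/eqP: ik; apply.
  by apply: val_inj; apply: (tA i k) => //; exists t.
have mf k : measurable_fun [set: T] (fun x => (k%:R * \1_(A k) x)%:E : \bar R).
  by apply/measurable_EFinP; apply: measurable_funM => //; exact: measurable_indic.
rewrite unlock (ae_eq_integral _ _ _ _ _ aeX)//; last 2 first.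
- by apply/measurable_EFinP.
- by apply: emeasurable_sum => k _; exact: mf.
rewrite ge0_integral_sum//.
rewrite -sumEFin; apply: eq_bigr => k _.
under eq_integral do rewrite EFinM.
rewrite ge0_integralZl//=; [|apply/measurable_EFinP; exact: measurable_indic].
by rewrite integral_indic// setIT EFinM; congr (_ * _)%E; exact: pX.
Qed.

(* [3 - 'E[I n]], in the form given in the statement. *)
Definition gap (R : realType) (n : nat) : R :=
  (n%:R + 2 ^+ n.-1) / 2 ^+ n * Num.sqrt pi * (Gamma n%:R / Gamma (n%:R + 1 / 2)).

Lemma prod_half_gt0 (R : realType) (n : nat) : 0 < \prod_(i < n) (i%:R + 1 / 2) :> R.
Proof. by apply: prodr_gt0 => i _; rewrite ltr_wpDl. Qed.

(** The factor sqrt(pi) cancels against the one in Gamma at a half-integer, leaving a rational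
    expression. *)
Lemma gapE (R : realType) (n : nat) :
  gap R n.+1 = (n.+1%:R + 2 ^+ n) / 2 ^+ n.+1 * (n`!%:R / \prod_(i < n.+1) (i%:R + 1 / 2)).
Proof.
rewrite /gap (GammaE _ _ _ (gamma_integral_nat R n.+1 isT)).
rewrite (GammaE _ _ _ (gamma_integral_nat_half R n.+1)) /=.
have := @prod_half_gt0 R n.+1; move: (\prod_(i < _) _) => p p0.
have pi0 : 0 < Num.sqrt pi :> R by rewrite sqrtr_gt0 pi_gt0.
by field; rewrite !gt_eqF ?exprn_gt0.
Qed.

Lemma expectation_gap (R : realType) (d : measure_display) (T : measurableType d)
    (P : probability T R) (n : nat) (X : {RV P >-> R}) : (0 < n)%N ->
  iterations_law 2 n X -> ('E_P[X] = (3 - gap R n)%:E)%E.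
Proof.
move=> n0 lawX; have S0 := prob_solvable_gt0 R n n0.
rewrite (expectation_nat_valued _ _ _ _ _ 4 _ lawX); last first.
  by rewrite -mulr_suml sum_prob_iterations// divff ?gt_eqF.
under eq_bigr do rewrite mulrA.
rewrite -mulr_suml mean_iterations//; congr EFin.
rewrite prob_solvable; case: n n0 {lawX S0} => // n _; rewrite gapE factS natrM.
have := @prod_half_gt0 R n.+1; move: (\prod_(i < _) _) => p p0.
rewrite exprS; field.
by rewrite !gt_eqF ?exprn_gt0// ?ltr0n ?fact_gt0// -natr1 ltr_wpDr.
Qed.

(** * Monotonicity in n *)

Lemma gap_decreasing (R : realType) (n : nat) : (0 < n)%N -> gap R n.+1 < gap R n.
Proof.
case: n => // n _; rewrite !gapE big_ord_recr/= factS natrM.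
have := @prod_half_gt0 R n.+1; move: (\prod_(i < _) _) => p p0.
have a0 : 0 < 2 ^+ n :> R by rewrite exprn_gt0.
have f0 : 0 < n`!%:R :> R by rewrite ltr0n fact_gt0.
have n0 : 0 <= n%:R :> R by [].
rewrite !exprS -2!natr1; move: (2 ^+ n) (n`!%:R) (n%:R) a0 f0 n0 => a f x a0 f0 x0.
(* With a = 2^n, f = n! and x = n, the terms in a x cancel and the numerator is (x + 1)^2 + a times
   f. *)
rewrite -subr_gt0 (_ : _ - _ = f * (x ^+ 2 + 2 * x + 1 + a) / (2 * a * p * (2 * x + 3))).
  by apply: divr_gt0; [apply: mulr_gt0 => //; nra|repeat apply: mulr_gt0 => //; lra].
field; rewrite !gt_eqF//; lra.
Qed.

Lemma gap_lt (R : realType) (n1 n2 : nat) : (0 < n1)%N -> (n1 < n2)%N -> gap R n2 < gap R n1.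
Proof.
move=> n10; elim: n2 => // n2 IH; rewrite ltnS leq_eqVlt => /predU1P[<-|/[dup] n12 /IH].
  exact: gap_decreasing.
by apply: lt_trans; apply: gap_decreasing; exact: leq_ltn_trans n12.
Qed.

(** * The limit *)

Lemma cvg_invr_natr (R : realType) : (n%:R^-1 : R) @[n --> \oo] --> 0.
Proof.
apply: (proj2 (@gtr0_cvgV0 R nat \oo _ (fun n => n%:R) _)); last exact: cvgr_idn.
by near=> n; rewrite ltr0n; near: n; exact: nbhs_infty_gt.
Unshelve. all: by end_near. Qed.

Lemma cvg_natr_div_exp2 (R : realType) : (n%:R / 2 ^+ n : R) @[n --> \oo] --> 0.
Proof.
(* This gives n / 2^n <= 2 / n. The induction step needs (n+1)^2 <= 2 n^2, true from n = 3 on;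
   smaller cases are computed. *)
have sq n : (n ^ 2 <= 2 * 2 ^ n)%N.
  elim: n => // -[|[|[|n]]] // IH.
  by rewrite (expnS 2 n.+3); move: (2 ^ n.+3)%N IH => a; nia.
apply: (@squeeze_cvgr _ _ _ _ (fun=> 0) (fun n => 2 * n%:R^-1)).
- near=> n; have n0 : (0 < n)%N by near: n; exact: nbhs_infty_gt.
  rewrite divr_ge0 ?exprn_ge0//= ler_pdivrMr ?exprn_gt0// mulrAC.
  rewrite ler_pdivlMr ?ltr0n// -expr2 -!natrX -natrM ler_nat; exact: sq.
- exact: cvg_cst.
- rewrite -[X in _ --> X](mulr0 2); apply: cvgMl_tmp; exact: cvg_invr_natr.
Unshelve. all: by end_near. Qed.

(** The two half-step inequalities place the ratio between 1 and sqrt(n + 1/2) / sqrt n, and the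
    latter is at most 1 + 1/n. *)
Lemma cvg_Gamma_ratio (R : realType) :
  (Num.sqrt n%:R * (Gamma n%:R / Gamma (n%:R + 1 / 2)) : R) @[n --> \oo] --> (1 : R).
Proof.
apply: (@squeeze_cvgr _ _ _ _ (fun=> 1) (fun n => 1 + n%:R^-1)).
- near=> n; have n0 : (0 < n)%N by near: n; exact: nbhs_infty_gt.
  have := Gamma_half_le R n n0; have := Gamma_half_ge R n n0.
  have : 0 < Gamma (n%:R + 1 / 2 : R).
    rewrite (GammaE _ _ _ (gamma_integral_nat_half R n)).
    by rewrite mulr_gt0 ?sqrtr_gt0 ?pi_gt0// prod_half_gt0.
  move: (Gamma _) (Gamma _) => u v v0 hu hv.
  have x0 : 0 < n%:R :> R by rewrite ltr0n.
  have s0 : 0 < Num.sqrt n%:R :> R by rewrite sqrtr_gt0.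
  rewrite mulrA ler_pdivlMr// mul1r hv ler_pdivrMr//=.
  rewrite -(ler_pM2l s0) mulrA -expr2 sqr_sqrtr ?(ltW x0)//.
  rewrite (le_trans hu)// mulrA ler_pM2r//.
  have nV0 : 0 < n%:R^-1 :> R by rewrite invr_gt0.
  have b0 : 0 <= Num.sqrt n%:R * (1 + n%:R^-1) :> R.
    by rewrite mulr_ge0 ?addr_ge0 ?ltW.
  rewrite -(ger0_norm b0) -sqrtr_sqr ler_sqrt ?sqr_ge0// exprMn sqr_sqrtr ?(ltW x0)//.
  (* After squaring, the bound to check is n + 1/2 <= n + 2 + 1/n. *)
  rewrite (_ : n%:R * (1 + n%:R^-1) ^+ 2 = n%:R + 2 + n%:R^-1); first lra.
  by field; rewrite gt_eqF.
- exact: cvg_cst.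
- rewrite -[X in _ --> X]addr0; apply: cvgD; [exact: cvg_cst|exact: cvg_invr_natr].
Unshelve. all: by end_near. Qed.

Lemma cvg_gap (R : realType) :
  (Num.sqrt n%:R * gap R n) @[n --> \oo] --> Num.sqrt pi / 2.
Proof.
have -> : Num.sqrt pi / 2 = (0 + 1 / 2) * Num.sqrt pi * 1 :> R by field.
have : ((n%:R / 2 ^+ n + 1 / 2) * Num.sqrt pi *
    (Num.sqrt n%:R * (Gamma n%:R / Gamma (n%:R + 1 / 2))) : R) @[n --> \oo] -->
    (0 + 1 / 2) * Num.sqrt pi * 1.
  apply: cvgM; last exact: cvg_Gamma_ratio.
  apply: cvgMr_tmp; apply: cvgD; first exact: cvg_natr_div_exp2.
  exact: cvg_cst.
apply: cvg_trans; apply: near_eq_cvg; near=> n.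
have n0 : (0 < n)%N by near: n; exact: nbhs_infty_gt.
(* The identity fails at n = 0, where the predecessor truncates, so it is used only eventually. *)
have -> : n%:R / 2 ^+ n + 1 / 2 = (n%:R + 2 ^+ n.-1) / 2 ^+ n :> R.
  rewrite mulrDl; congr (_ + _); rewrite -[in RHS](prednK n0) exprS; field.
  by rewrite expf_neq0 ?pnatr_eq0.
by rewrite /gap; ring.
Unshelve. all: by end_near. Qed.

Theorem proposition2 (R : realType)
    (d : nat -> measure_display) (T : forall n : nat, measurableType (d n))
    (P : forall n : nat, probability (T n) R)
    (I : forall n : nat, {RV (P n) >-> R})
    (hI : forall n : nat, (1 <= n)%N -> iterations_law 2 n (I n)) :
  [/\ forall n : nat, (1 <= n)%N ->
        ('E_(P n)[I n])%E =
        (3 - (n%:R + 2 ^+ n.-1) / 2 ^+ n * Num.sqrt pi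
             * (Gamma n%:R / Gamma (n%:R + 1 / 2)))%:E,
      forall n1 n2 : nat, (1 <= n1)%N -> (n1 < n2)%N ->
        ('E_(P n1)[I n1] < 'E_(P n2)[I n2])%E
    & ((n%:R `^ (1 / 2))%:E * (3%:E - 'E_(P n)[I n]))%E @[n --> \oo]
        --> (Num.sqrt pi / 2 : R)%:E].
Proof.
have EI n : (1 <= n)%N -> ('E_(P n)[I n] = (3 - gap R n)%:E)%E.
  by move=> n0; apply: expectation_gap => //; exact: hI.
split=> [n /EI//|n1 n2 n10 n12|].
  rewrite !EI ?(leq_trans n10 (ltnW n12))// lte_fin ltrD2l ltrN2.
  exact: gap_lt.
(* The expectation is known only for n >= 1, so the extended-real sequence is replaced by the real
   one for large n. *)
suff : (Num.sqrt n%:R * gap R n)%:E @[n --> \oo] --> (Num.sqrt pi / 2 : R)%:E.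
  apply: cvg_trans; apply: near_eq_cvg; near=> n.
  rewrite EI; last by near: n; exact: nbhs_infty_gt.
  by rewrite -EFinB -EFinM div1r powR12_sqrt// opprB addrC subrK.
apply: cvg_EFin; [by near=> n|exact: cvg_gap].
Unshelve. all: by end_near. Qed.
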